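(* Let $X$ and $Y$ be topological spaces satisfying at least one of the following two assumptions: (a) $X$ is a separable pseudocompact space and $Y$ is a compact space; (b) $X$ is a pseudocompact space with countable Suslin number and $Y$ is a Valdivia compact space. Let $x_0\in X$ and $y_0\in Y$ be non-isolated points in the corresponding spaces. Then the following conditions are equivalent: (i) there exist sequences $(U_n)_{n=1}^{\infty}$ and $(V_n)_{n=1}^{\infty}$ of nonempty open sets $U_n\subseteq X$ and $V_n\subseteq Y$ which converge to $x_0$ and $y_0$ respectively; (ii) there exists a separately continuous function $f:X\times Y\to\mathbb R$ with $D(f)=\{(x_0,y_0)\}$.
   Context: Compact spaces and completely regular spaces are assumed to be Hausdorff. A completely regular space $X$ is pseudocompact if every continuous function $g:X\to\mathbb R$ is bounded. A topological space $X$ has countable Suslin number if every system of nonempty pairwise disjoint open sets in $X$ is at most countable. For $z\in\mathbb R^T$ put ${\rm supp}\,z=\{t\in T: z(t)\neq 0\}$. A compact space $Y$ is a Valdivia compact if $Y$ is homeomorphic to a compact space $Z\subseteq\mathbb R^T$ (for some set $T$, with the product topology on $\mathbb R^T$) such that the set $\{z\in Z: |{\rm supp}\,z|\le\aleph_0\}$ is dense in $Z$. A sequence $(A_n)_{n=1}^{\infty}$ of nonempty subsets of a topological space $X$ converges to a point $x_0\in X$ if for every neighborhood $U$ of $x_0$ in $X$ there exists an integer $n_0$ such that $A_n\subseteq U$ for all $n\ge n_0$. A function $f:X\times Y\to\mathbb R$ is separately continuous if for every $x\in X$ the function $y\mapsto f(x,y)$ is continuous on $Y$ and for every $y\in Y$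 the function $x\mapsto f(x,y)$ is continuous on $X$. $D(f)$ denotes the set of all points of discontinuity of $f$ (with respect to the product topology on $X\times Y$). *)

(* Defs.v *)
From mathcomp Require Import all_boot all_order all_algebra.
From mathcomp Require Import all_classical all_reals all_analysis.
Import Order.TTheory GRing.Theory Num.Theory.
Import numFieldNormedType.Exports.

Set Implicit Arguments.
Unset Strict Implicit.
Unset Printing Implicit Defensive.

Local Open Scope classical_set_scope.
Local Open Scope ring_scope.

Definition compact_space (X : topologicalType) : Prop :=
  hausdorff_space X /\ compact [set: X].

(* [uniform_separatorP] unfolds [completely_regular_space] into separation of
   points from closed sets by continuous real-valued functions. *)
Definition pseudocompact_space (R : realType) (X : topologicalType) : Prop :=
  [/\ hausdorff_space X, completely_regular_space X &
    forall g : X -> R, continuous g -> bounded_fun g].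

Definition separable_space (X : topologicalType) : Prop :=
  exists2 D : set X, countable D & dense D.

Definition countable_suslin_number (X : topologicalType) : Prop :=
  forall S : set (set X),
    (forall A, S A -> open A /\ A !=set0) ->
    (forall A B, S A -> S B -> A <> B -> A `&` B = set0) ->
    countable S.

Definition homeomorphic (X Y : topologicalType) : Prop :=
  exists (f : X -> Y) (g : Y -> X),
    [/\ continuous f, continuous g, cancel f g & cancel g f].

(* A subset [Z] coerces to the type of its points, which carries the subspace
   topology; [prod_topology] is the product (pointwise) topology on R^T. *)
Definition valdivia_compact (R : realType) (Y : topologicalType) : Prop :=
  compact_space Y /\
  exists (T : Type) (Z : set (prod_topology (fun _ : T => R))),
    [/\ compact Z, homeomorphic Y Z &
      dense [set z : Z | countable [set t : T | \val z t != 0]]].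

Definition sets_converge (X : topologicalType) (A : nat -> set X) (x : X) :
    Prop :=
  forall U, nbhs x U -> \forall n \near \oo, A n `<=` U.

Definition separately_continuous (X Y Z : topologicalType) (f : X * Y -> Z) :
    Prop :=
  (forall x, continuous (fun y => f (x, y))) /\
  (forall y, continuous (fun x => f (x, y))).

Definition discontinuity_set (X Y : topologicalType) (f : X -> Y) : set X :=
  [set x | ~ {for x, continuous f}].

(* Main.v *)
Require Import Defs.
From mathcomp Require Import all_boot all_order all_algebra.
From mathcomp Require Import all_classical all_reals all_analysis.
From mathcomp Require Import lra.
Import Order.TTheory GRing.Theory Num.Theory.
Import numFieldNormedType.Exports.

Local Open Scope classical_set_scope.
Local Open Scope ring_scope.

(** From the rectangles to the function: shrink [U_n] and [V_n] so that they
    avoid [x0] and [y0], choose bump functions [phi_n] and [psi_n] supported in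
    them, and put [f (x, y) = sum_n phi_n x * psi_n y].  Off [(x0, y0)] one of
    the coordinates has a neighbourhood that meets only finitely many supports,
    so [f] is locally a finite sum of continuous functions; [f] vanishes on the
    cross through [(x0, y0)] and is at least 1 at points of each [U_n * V_n]
    ([rectangles_discontinuity]).

    From the function to the rectangles: subtracting
    [f (x0, y) + f (x, y0) - f (x0, y0)], which is continuous, gives a function
    [g] with the same discontinuity that vanishes on the cross.  For some
    [e > 0], points with [|g| > e] accumulate at [(x0, y0)].  Suppose there is
    a sequence [a_k] in [X] that detects zero sections: if [g (a_k, y) = 0] for
    all [k], then [g (., y) = 0].  Choose nonempty open [U_n] and [V_n] with
    [|g| > e] on [U_n * V_n] and [|g (a_k, .)| < 1 / (n + 1)] on [V_n] for
    [k <= n].  At an accumulation point [(x, b)] of these rectangles,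
    [g (a_k, b) = 0] for all [k], so [g (x, b) = 0]; were [g] continuous there,
    [|g| > e] would fail nearby.  Hence [(x0, y0)] is the only accumulation
    point, also for all subsequences of smaller rectangles.  Rectangles in the
    product of a pseudocompact and a compact space always accumulate
    ([pseudocompact_compact_cluster]), so the [U_n] and the [V_n] converge
    ([discontinuity_rectangles]).

    The detecting sequence is a dense sequence when [X] is separable.  When [X]
    has countable Suslin number, its existence follows from a double limit
    argument.  Pseudocompactness of [X] and compactness of [Y] forbid points
    with [|g (x_m, y_n)| > d] for [n <= m] and [g (x_m, y_n) = 0] for [m < n]
    ([no_half_graph]).  If no countable subset of [X] detected the sections
    that exceed [d], the Suslin condition would give an open set all of whose
    nonempty open subsets inherit that failure, and such a configuration could
    be built inside it point by point ([suslin_small_kernel]). *)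

Set Implicit Arguments.
Unset Strict Implicit.

(** * Continuity, bump functions and locally finite series *)

Lemma open_norm_gt (R : realType) (Z : topologicalType) (h : Z -> R) (c : R) :
  continuous h -> open [set z | c < `|h z|].
Proof.
move=> hc; rewrite openE => z /= cz; exact: cvgr_norm_gt _ (hc z) _ cz.
Qed.

Lemma open_norm_lt (R : realType) (Z : topologicalType) (h : Z -> R) (c : R) :
  continuous h -> open [set z | `|h z| < c].
Proof.
move=> hc; rewrite openE => z /= cz; exact: cvgr_norm_lt _ (hc z) _ cz.
Qed.

Lemma continuous_slices (X Y Z : topologicalType) (f : X * Y -> Z)
    (a : X) (b : Y) :
  {for (a, b), continuous f} ->
  {for b, continuous (fun y => f (a, y))} /\
  {for a, continuous (fun x => f (x, b))}.
Proof.
move=> fc; split.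
  apply: (@cvg_comp _ _ _ (fun y => (a, y)) f _ (nbhs (a, b))); last exact: fc.
  by apply: cvg_pair; [exact: cvg_cst | exact: cvg_id].
apply: (@cvg_comp _ _ _ (fun x => (x, b)) f _ (nbhs (a, b))); last exact: fc.
by apply: cvg_pair; [exact: cvg_id | exact: cvg_cst].
Qed.

Lemma bump_function (R : realType) (X : topologicalType) (U : set X) (x : X) :
  completely_regular_space X -> open U -> U x ->
  exists phi : X -> R,
    [/\ continuous phi, forall z, 0 <= phi z, phi x = 1 &
      forall z, ~ U z -> phi z = 0].
Proof.
move=> crX oU Ux.
have /(@uniform_separatorP _ R)[f [cf f01 f0 f1]] :
    uniform_separator [set x] (~` U).
  by apply: crX; [exact: open_closedC | move=> /(_ Ux)].
exists (fun z => 1 - f z); split.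
- by move=> z; apply: cvgB; [exact: cvg_cst | exact: cf].
- move=> z; have /f01 : range f (f z) by exists z.
  by rewrite /= in_itv /= => /andP[_]; rewrite subr_ge0.
- by rewrite (f0 (f x)) ?subr0//; exists x.
- by move=> z nUz; rewrite (f1 (f z)) ?subrr//; exists z.
Qed.

(** Meaningful at points where all but finitely many terms vanish, so that the
    partial sums are eventually constant. *)
Definition pointwise_series (R : realType) (Z : Type) (h : nat -> Z -> R)
    (z : Z) : R :=
  limn (fun n => \sum_(i < n) h i z).

Lemma pointwise_seriesE (R : realType) (Z : Type) (h : nat -> Z -> R)
    (N : nat) (z : Z) :
  (forall n, (N <= n)%N -> h n z = 0) ->
  pointwise_series h z = \sum_(i < N) h i z.
Proof.
move=> h0; apply: norm_lim_near_cst; exists N => // n /= Nn.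
rewrite -(subnKC Nn) big_split_ord /= [X in _ + X]big1 ?addr0// => i _.
by rewrite h0//= leq_addr.
Qed.

Lemma le_pointwise_series (R : realType) (Z : Type) (h : nat -> Z -> R)
    (N : nat) (z : Z) (k : nat) :
  (forall n, 0 <= h n z) -> (forall n, (N <= n)%N -> h n z = 0) ->
  h k z <= pointwise_series h z.
Proof.
move=> h0 hN; rewrite (@pointwise_seriesE _ _ h (maxn N k.+1)).
  have kN : (k < maxn N k.+1)%N by rewrite leq_max leqnn orbT.
  by rewrite (bigD1 (Ordinal kN))//= lerDl sumr_ge0.
by move=> n; rewrite geq_max => /andP[/hN].
Qed.

Lemma continuous_pointwise_series (R : realType) (Z : topologicalType)
    (h : nat -> Z -> R) (N : nat) (z : Z) :
  (forall n, {for z, continuous (h n)}) ->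
  (\forall w \near z, forall n, (N <= n)%N -> h n w = 0) ->
  {for z, continuous (pointwise_series h)}.
Proof.
move=> hc h0.
have hE : \forall w \near z, \sum_(i < N) h i w = pointwise_series h w.
  by apply: filterS h0 => w hw; rewrite (pointwise_seriesE hw).
rewrite /prop_for /continuous_at -(nbhs_singleton hE).
apply: cvg_trans; first exact: near_eq_cvg hE.
by apply: cvg_big => [|i _]; [exact: add_continuous | exact: hc].
Qed.

(** * Accumulation in pseudocompact and compact spaces *)

(** If the [U_n] were locally finite, a sum of bumps of height [n] supported in
    [U_n] would be a continuous unbounded function. *)
Lemma pseudocompact_cluster (R : realType) (X : topologicalType)
    (U : nat -> set X) :
  pseudocompact_space R X -> (forall n, open (U n) /\ U n !=set0) ->
  exists x : X, forall O, nbhs x O ->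
    forall N, exists2 n, (N <= n)%N & U n `&` O !=set0.
Proof.
move=> [_ crX bX] UP; apply: contrapT => noC.
have locfin (x : X) : exists N,
    \forall w \near x, forall n, (N <= n)%N -> ~ U n w.
  apply: contrapT => noN; apply: noC; exists x => O xO N.
  apply: contrapT => nON; apply: noN; exists N.
  apply: filterS xO => w Ow n Nn Unw; apply: nON; exists n => //.
  by exists w.
have /choice[x Ux] n : exists x, U n x by have [] := (UP n).2 => x; exists x.
have /choice[phi phiP] n := bump_function R crX (UP n).1 (Ux n).
pose h n z : R := n%:R * phi n z.
have hge n z : 0 <= h n z by have [_ p0 _ _] := phiP n; rewrite mulr_ge0.
have h0 n z : ~ U n z -> h n z = 0.
  by have [_ _ _ p0] := phiP n; move=> /p0; rewrite /h => ->; rewrite mulr0.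
have /bX[M [_ bM]] : continuous (pointwise_series h).
  move=> z; have [N zN] := locfin z.
  apply: (@continuous_pointwise_series _ _ _ N) => [n|].
    have [pc _ _ _] := phiP n.
    by apply: continuousM; [exact: cst_continuous | exact: pc].
  by apply: filterS zN => w wN n /wN /h0.
pose k := Num.truncn (`|M| + 1).
have : `|pointwise_series h (x k.+1)| <= `|M| + 1.
  by apply: bM => //; rewrite (le_lt_trans (ler_norm _))// ltrDl.
rewrite leNgt => /negP; apply; apply: lt_le_trans (ler_norm _).
have [N /nbhs_singleton xN] := locfin (x k.+1).
apply: (@lt_le_trans _ _ (h k.+1 (x k.+1))).
  have [_ _ phi1 _] := phiP k.+1.
  by rewrite /h phi1 mulr1 truncnS_gt.
by apply: (@le_pointwise_series _ _ _ N) => // n /xN /h0.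
Qed.

(** An accumulation point [a] of the [U_n] is found first.  The sets of those
    [y_n] whose [U_n] meets a given neighbourhood of [a], with [n] large, form
    a filter base, and compactness of [Y] gives it a cluster point. *)
Lemma pseudocompact_compact_cluster (R : realType) (X Y : topologicalType)
    (U : nat -> set X) (y : nat -> Y) :
  pseudocompact_space R X -> compact [set: Y] ->
  (forall n, open (U n) /\ U n !=set0) ->
  exists (a : X) (b : Y), forall O O', nbhs a O -> nbhs b O' ->
    forall N, exists n, [/\ (N <= n)%N, U n `&` O !=set0 & O' (y n)].
Proof.
move=> pX cY UP; have [a aP] := @pseudocompact_cluster R X U pX UP.
exists a.
pose D := [set i : set X * nat | nbhs a i.1].
pose B (i : set X * nat) :=
  [set y n | n in [set n | (i.2 <= n)%N /\ U n `&` i.1 !=set0]].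
have FB : Filter (filter_from D B).
  apply: filter_from_filter; first by exists (setT, 0%N); exact: filterT.
  case=> [A N] [A' N'] /= DA DA'.
  exists (A `&` A', maxn N N'); first exact: filterI.
  move=> _ [n [/= + [w [Uw [Aw A'w]]]] <-]; rewrite geq_max => /andP[Nn N'n].
  by split; exists n => //; split => //; exists w.
have PB : ProperFilter (filter_from D B).
  apply: filter_from_proper => i /=; case: i => A N /= DA.
  by have [n Nn UO] := aP A DA N; exists (y n); exists n.
have [b [_ bP]] := cY _ PB (filterT).
exists b => O O' aO bO' N.
have [|_ [[n [/= Nn UO] <-] O'n]] := bP (B (O, N)) O' _ bO'.
  by exists (O, N).
by exists n.
Qed.

(** Both iterated limits of such a double sequence would have to describe the
    value of [g] at one point.  Let [b] be a cluster point of the [y_n], so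
    that [g (x_m, b) = 0] for all [m].  The [x_m] themselves need not
    accumulate, hence each is replaced by a neighbourhood on which the finitely
    many relevant inequalities persist; at an accumulation point [a] of these
    neighbourhoods, [|g (a, b)|] is at most [d / 2] by the limit in [m] and at
    least [d] by the limit in [n]. *)
Lemma no_half_graph (R : realType) (X Y : topologicalType) (g : X * Y -> R)
    (x : nat -> X) (y : nat -> Y) (d : R) :
  pseudocompact_space R X -> compact [set: Y] -> separately_continuous g ->
  0 < d ->
  (forall m n, (n <= m)%N -> d < `|g (x m, y n)|) ->
  (forall m n, (m < n)%N -> g (x m, y n) = 0) -> False.
Proof.
move=> pX cY [gy gx] d0 gbig gsmall.
have [b bP] : exists b : Y, forall O, nbhs b O ->
    forall N, exists2 n, (N <= n)%N & O (y n).
  have [b [_ bP]] := cY (y @ \oo) _ filterT.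
  exists b => O bO N.
  have [|_ [[n /= Nn <-] On]] :=
      bP [set y n | n in [set n | (N <= n)%N]] O _ bO.
    by exists N => // n Nn; exists n.
  by exists n.
have gxb m : g (x m, b) = 0.
  apply: contrapT => /eqP; rewrite -normr_gt0 => g0.
  have [n mn] := bP _ (cvgr_norm_gt _ (gy (x m) b) _ g0) m.+1.
  by rewrite /= gsmall// normr0 ltxx.
pose U m := [set z | `|g (z, b)| < d / 2] `&`
  [set z | forall n : 'I_m.+1, d < `|g (z, y n)|].
have UP m : open (U m) /\ U m !=set0.
  split.
    apply: openI; first exact: open_norm_lt (gx b).
    rewrite openE => z zd; apply: filter_forall => n.
    exact: cvgr_norm_gt _ (gx (y n) z) _ (zd n).
  exists (x m); split; first by rewrite /= gxb normr0 divr_gt0.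
  by move=> n /=; apply: gbig; rewrite -ltnS.
have [a aP] := @pseudocompact_cluster R X U pX UP.
have small : `|g (a, b)| <= d / 2.
  rewrite leNgt; apply/negP => big.
  have [m _ [z [[zs _] /= zb]]] := aP _ (cvgr_norm_gt _ (gx b a) _ big) 0%N.
  by have := lt_trans zb zs; rewrite ltxx.
have big n : d <= `|g (a, y n)|.
  rewrite leNgt; apply/negP => sm.
  have [m nm [z [[_ zd] /= zb]]] := aP _ (cvgr_norm_lt _ (gx (y n) a) _ sm) n.
  have nm1 : (n < m.+1)%N by rewrite ltnS.
  by have := lt_trans (zd (Ordinal nm1)) zb; rewrite ltxx.
have : `|g (a, b)| < d by apply: le_lt_trans small _; lra.
move=> sm; have [n _ /=] := bP _ (cvgr_norm_lt _ (gy a b) _ sm) 0%N.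
by rewrite ltNge big.
Qed.

(** * Countable sets that detect zero sections *)

(** A maximal disjoint family of open members of [P] is countable by the Suslin
    condition, and has dense union by maximality. *)
Lemma suslin_dense_family (X : topologicalType) (P : set (set X)) :
  countable_suslin_number X ->
  (forall W, open W -> W !=set0 ->
    exists W', [/\ W' `<=` W, open W', W' !=set0 & P W']) ->
  exists E : set (set X),
    [/\ countable E, E `<=` P &
      dense (\bigcup_(W in E) W)].
Proof.
move=> sX PW.
have [E [ED tE maxE]] := @ex_maximal_disjoint_subcollection _ _ (@id (set X))
  [set W | [/\ open W, W !=set0 & P W]].
exists E; split.
- apply: sX => [A /ED[]//|A B EA EB AB].
  by apply: contrapT => /eqP/set0P AB0; apply: AB; exact: tE AB0.
- by move=> A /ED[].
- move=> O O0 oO; apply: contrapT => OE.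
  have [W [WO oW W0 PWW]] := PW O oO O0.
  have disj A : E A -> A `&` W = set0.
    move=> EA; rewrite -subset0 => w [Aw Ww]; apply: OE.
    by exists w; split; [exact: WO | exists A].
  have nEW : ~ E W.
    by move=> /disj; rewrite setIid => W00; move: W0; rewrite W00 => -[].
  apply: (maxE (E `|` [set W])).
  + split; first by move=> ?; left.
    by move=> /(_ W (or_intror erefl)).
  + by move=> A [/ED//|->].
  + move=> A B [EA|->] [EB|->]//.
    * exact: tE.
    * by rewrite disj// => -[].
    * by rewrite setIC disj// => -[].
Qed.

(** Call an open set recurrent if every countable [L] is killed by some [y]
    whose section is large somewhere in that set.  If the lemma fails, some
    nonempty open [W] has only recurrent nonempty open subsets: otherwise there
    would be a countable family of nonrecurrent open sets with dense union, and
    the union of their witnesses would be the required set.  Inside [W], each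
    new [y] kills the points chosen so far, and the next point is taken where
    the section of every [y] chosen so far is large; this contradicts
    [no_half_graph]. *)
Lemma suslin_small_kernel (R : realType) (X Y : topologicalType)
    (g : X * Y -> R) (d : R) :
  pseudocompact_space R X -> countable_suslin_number X ->
  compact [set: Y] -> separately_continuous g -> 0 < d ->
  exists2 A : set X, countable A &
    forall y, (forall a, A a -> g (a, y) = 0) -> forall x, `|g (x, y)| <= d.
Proof.
move=> pX sX cY cg d0; have [gy gx] := cg; apply: contrapT => noA.
pose kills (L : set X) y := forall a, L a -> g (a, y) = 0.
pose G y := [set x | d < `|g (x, y)|].
have oG y : open (G y) by exact: open_norm_gt (gx y).
pose recurrent (W : set X) := forall L, countable L ->
  exists2 y, kills L y & W `&` G y !=set0.
have [W [oW W0 Wrec]] : exists W : set X, [/\ open W, W !=set0 &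
    forall W', W' `<=` W -> open W' -> W' !=set0 -> recurrent W'].
  apply: contrapT => noW.
  have [W oW W0|E [cE EN dE]] :=
      @suslin_dense_family X (fun W => ~ recurrent W) sX.
    apply: contrapT => noW'; apply: noW; exists W; split => // W' W'W oW' W'0.
    by apply: contrapT => nr; apply: noW'; exists W'.
  have /choice[L LP] (W : set X) : exists L : set X, E W ->
      countable L /\ forall y, kills L y -> W `&` G y = set0.
    have [EW|nEW] := pselect (E W); last by exists set0.
    have : ~ recurrent W by exact: EN.
    move=> /existsNP[L] /not_implyP[cL nL]; exists L => _; split => // y Ly.
    by apply: contrapT => /eqP/set0P WG; apply: nL; exists y.
  apply: noA; exists (\bigcup_(W in E) L W).
    by apply: bigcup_countable => // W /LP[].
  move=> y Ly x; rewrite leNgt; apply/negP => Gx.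
  have [|z [Gz [W EW Wz]]] := dE (G y) _ (oG y); first by exists x.
  have [_ /(_ y)] := LP W EW; rewrite -subset0 => LW; apply: (LW _ z) => //.
  by move=> a La; apply: Ly; exists W.
(* A state holds the current open set, the countable set of points to be
   killed next, and the last point and section chosen. *)
pose state := (set X * set X * X * Y)%type.
pose inv (s : state) := let: (V, L, x, y) := s in
  [/\ V `<=` W, open V, V !=set0 & countable L].
pose step (s s' : state) :=
  let: (V, L, x, y) := s in let: (V', L', x', y') := s' in
  [/\ kills L y', V' `<=` V `&` G y', V' x' & L' = L `|` [set x']].
have next s : {s' | inv s -> inv s' /\ step s s'}.
  apply: cid; move: s => [[[V L] x] y].
  have [[VW oV V0 cL]|ninv] := pselect (inv (V, L, x, y)); last first.
    by exists (V, L, x, y).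
  have [y' Ly' [x' [Vx' Gx']]] := Wrec V VW oV V0 L cL.
  exists (V `&` G y', L `|` [set x'], x', y') => _; split; split => //.
  - by move=> z [/VW].
  - exact: openI.
  - by exists x'.
  - rewrite -bigcup2E; apply: bigcup_countable => // -[|[|i]] _ //=.
have [w Ww] := W0.
have [y0 _ _] := Wrec W (@subset_refl _ W) oW W0 set0 (countable0 X).
have [s [s0 sS]] := dependent_choice next (W, set0, w, y0).
have invs n : inv (s n).
  elim: n => [|n IH]; last by have [] := sS n IH.
  by rewrite s0; split => //; exact: countable0.
have steps n : step (s n) (s n.+1) by have [] := sS n (invs n).
pose V n := (s n).1.1.1; pose L n := (s n).1.1.2.
pose x n := (s n).1.2; pose y n := (s n).2.
have stepE n : [/\ kills (L n) (y n.+1), V n.+1 `<=` V n `&` G (y n.+1),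
    V n.+1 (x n.+1) & L n.+1 = L n `|` [set x n.+1]].
  move: (steps n); rewrite /V /L /x /y.
  by case: (s n) (s n.+1) => [[[? ?] ?] ?] [[[? ?] ?] ?].
have Vle m n : (m <= n)%N -> V n `<=` V m.
  move=> /subnK <-; elim: (n - m)%N => // k IH z.
  by have [_ VS _ _] := stepE (k + m)%N; rewrite addSn => /VS[/IH].
have Lle m n : (m <= n)%N -> L m `<=` L n.
  move=> /subnK <-; elim: (n - m)%N => // k IH z /IH.
  by have [_ _ _ LS] := stepE (k + m)%N; rewrite addSn LS; left.
(* The initial state carries arbitrary points, so the sequences start at 1. *)
apply: (@no_half_graph R X Y g (x \o succn) (y \o succn) d) => // m n /= mn.
- have [_ _ xm _] := stepE m; have [_ yn _ _] := stepE n.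
  have /yn[] : V n.+1 (x m.+1) by exact: Vle xm.
  by [].
- have [kn _ _ _] := stepE n; apply: kn; apply: Lle mn _ _.
  by have [_ _ _ ->] := stepE m; right.
Qed.

Lemma countable_enumeration (T : Type) (A : set T) (x0 : T) :
  countable A -> exists a : nat -> T, forall x, A x -> exists n, a n = x.
Proof.
move=> /pfcard_geP[->|[f]]; first by exists (fun=> x0).
exists f => x /(@surj _ _ _ _ f)[n _ <-].
by exists n.
Qed.

Lemma separable_kernel (R : realType) (X Y : topologicalType)
    (g : X * Y -> R) :
  separable_space X -> separately_continuous g ->
  exists2 A : set X, countable A &
    forall y, (forall a, A a -> g (a, y) = 0) -> forall x, g (x, y) = 0.
Proof.
move=> [D cD dD] [_ gx]; exists D => // y gD x; apply: contrapT => /eqP gxy.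
have [|z [gz Dz]] := dD [set x | 0 < `|g (x, y)|] _ (open_norm_gt 0 (gx y)).
  by exists x => /=; rewrite normr_gt0.
by move: gz; rewrite /= gD// normr0 ltxx.
Qed.

Lemma suslin_kernel (R : realType) (X Y : topologicalType) (g : X * Y -> R) :
  pseudocompact_space R X -> countable_suslin_number X ->
  compact [set: Y] -> separately_continuous g ->
  exists2 A : set X, countable A &
    forall y, (forall a, A a -> g (a, y) = 0) -> forall x, g (x, y) = 0.
Proof.
move=> pX sX cY cg.
have /choice[A AP] (n : nat) : exists A : set X, countable A /\
    forall y, (forall a, A a -> g (a, y) = 0) ->
      forall x, `|g (x, y)| <= n.+1%:R^-1.
  have n0 : 0 < n.+1%:R^-1 :> R by rewrite invr_gt0.
  by have [A] := suslin_small_kernel pX sX cY cg n0; exists A.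
exists (\bigcup_n A n).
  by apply: bigcup_countable => // n _; exact: (AP n).1.
move=> y gA x; apply: contrapT => /eqP; rewrite -normr_gt0 => gpos.
have : `|g (x, y)| <= (Num.truncn (`|g (x, y)|^-1)).+1%:R^-1.
  by apply: (AP _).2 => a Aa; apply: gA; exists (Num.truncn (`|g (x, y)|^-1)).
rewrite leNgt => /negP; apply.
by rewrite invf_plt ?posrE// truncnS_gt.
Qed.

(** * From a discontinuity to converging rectangles *)

Lemma discontinuous_norm (R : realType) (Z : topologicalType) (g : Z -> R)
    (p : Z) :
  g p = 0 -> ~ {for p, continuous g} ->
  exists2 e : R, 0 < e & forall P, nbhs p P -> exists2 q, P q & e < `|g q|.
Proof.
move=> gp dg; apply: contrapT => noe; apply: dg.
rewrite /prop_for /continuous_at gp; apply/cvgr0Pnorm_lt => e e0.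
apply: contrapT => nne; apply: noe; exists (e / 2); first by rewrite divr_gt0.
move=> P pP; apply: contrapT => noq; apply: nne.
apply: filterS pP => q Pq; rewrite ltNge; apply/negP => gq; apply: noq.
by exists q => //; lra.
Qed.

(** The [a_k] force every accumulation point of the chosen rectangles onto
    [(x0, y0)].  If one of the two sequences did not converge, infinitely many
    of the rectangles could be shrunk so as to stay away from [x0] or [y0],
    and they would still have to accumulate. *)
Lemma discontinuity_rectangles (R : realType) (X Y : topologicalType)
    (x0 : X) (y0 : Y) (g : X * Y -> R) (a : nat -> X) :
  pseudocompact_space R X -> compact [set: Y] -> separately_continuous g ->
  (forall x, g (x, y0) = 0) ->
  (forall p, p <> (x0, y0) -> {for p, continuous g}) ->
  ~ {for (x0, y0), continuous g} ->
  (forall y, (forall k, g (a k, y) = 0) -> forall x, g (x, y) = 0) ->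
  exists (U : nat -> set X) (V : nat -> set Y),
     [/\ forall n, open (U n) /\ U n !=set0,
         forall n, open (V n) /\ V n !=set0,
         sets_converge U x0 & sets_converge V y0].
Proof.
move=> pX cY [gy gx] g0 cg dg ag.
have [e e0 eP] := discontinuous_norm (g0 x0) dg.
have rect n : exists UV : set X * set Y,
    [/\ open UV.1 /\ UV.1 !=set0, open UV.2 /\ UV.2 !=set0,
      forall x y, UV.1 x -> UV.2 y -> e < `|g (x, y)| &
      forall y k, UV.2 y -> (k <= n)%N -> `|g (a k, y)| < n.+1%:R^-1].
  have small : \forall y \near y0, forall k : 'I_n.+1,
      `|g (a k, y)| < n.+1%:R^-1.
    apply: filter_forall => k; apply: cvgr_norm_lt _ (gy (a k) y0) _ _.
    by rewrite g0 normr0 invr_gt0.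
  have [[x y] /= ys gxy] : exists2 p : X * Y,
      nbhs p.2 [set y | forall k : 'I_n.+1, `|g (a k, y)| < n.+1%:R^-1] &
      e < `|g p|.
    apply: eP; apply: cvg_snd (nbhs_interior small).
  have pxy : (x, y) <> (x0, y0).
    by case=> xx0 yy0; move: gxy; rewrite yy0 g0 normr0 ltNge ltW.
  have [[A B] [/= xA yB] AB] := cvgr_norm_gt _ (cg _ pxy) _ gxy.
  exists (A°, (B `&` [set y | forall k : 'I_n.+1,
    `|g (a k, y)| < n.+1%:R^-1])°); split => /=.
  - by split; [exact: open_interior | exists x].
  - by split; [exact: open_interior | exists y; exact: filterI].
  - move=> x' y' /interior_subset Ax' /interior_subset[By' _].
    exact: (AB (x', y')).
  - move=> y' k /interior_subset[_ /= sm]; rewrite -ltnS => kn.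
    exact: (sm (Ordinal kn)).
have /choice[UV UVP] := rect.
have oU n : open (UV n).1 /\ (UV n).1 !=set0 by have [] := UVP n.
have oV n : open (UV n).2 /\ (UV n).2 !=set0 by have [] := UVP n.
(* The rectangles in question may be thinned out along [s], shrunk on the side
   of [X], and replaced by points on the side of [Y]. *)
have clust (U : nat -> set X) (y : nat -> Y) (s : nat -> nat) :
    (forall n, (n <= s n)%N) -> (forall n, open (U n) /\ U n !=set0) ->
    (forall n, U n `<=` (UV (s n)).1) -> (forall n, (UV (s n)).2 (y n)) ->
    forall A B, nbhs x0 A -> nbhs y0 B ->
      exists n, U n `&` A !=set0 /\ B (y n).
  move=> sn oUn Us ys.
  have [x [b xb]] := pseudocompact_compact_cluster y pX cY oUn.
  have gb : forall z, g (z, b) = 0.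
    apply: ag => k; apply: contrapT => /eqP; rewrite -normr_gt0 => gk.
    (* Half of [|g (a k, b)|] is a lower bound for [|g (a k, y n)|] that [V_n]
       excludes once 1 / (n + 1) drops below it. *)
    have gk2 : `|g (a k, b)| / 2 < `|g (a k, b)| by lra.
    have [n [kn _ /=]] := xb _ _ filterT (cvgr_norm_gt _ (gy (a k) b) _ gk2)
      (maxn k (Num.truncn ((`|g (a k, b)| / 2)^-1))).
    move: kn; rewrite geq_max => /andP[kn tn].
    have [_ _ _ /(_ (y n) k (ys n) (leq_trans kn (sn n))) sm] := UVP (s n).
    move=> /lt_trans/(_ sm); rewrite ltNge => /negP; apply.
    rewrite ltW// invf_plt ?posrE ?divr_gt0//.
    apply: lt_le_trans (truncnS_gt _) _.
    by rewrite ler_nat ltnS (leq_trans tn).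
  have [xb0|nxb0] := pselect ((x, b) = (x0, y0)).
    case: xb0 => <- <- A B xA yB.
    by have [n [_ UA By]] := xb A B xA yB 0%N; exists n.
  have gxb : `|g (x, b)| < e by rewrite gb normr0.
  have [[A B] [/= xA yB] AB] := cvgr_norm_lt _ (cg _ nxb0) _ gxb.
  have [n [_ [z [Uz Az]] By]] := xb A B xA yB 0%N.
  have := AB (z, y n) (conj Az By); rewrite /= ltNge ltW//.
  by have [_ _ big _] := UVP (s n); apply: big => //; exact: Us.
exists (fun n => (UV n).1), (fun n => (UV n).2); split => //.
- move=> O xO; apply: contrapT => nO.
  have /choice[s sP] n : exists m, (n <= m)%N /\ ~ (UV m).1 `<=` O.
    apply: contrapT => nm; apply: nO; exists n => // m /= nm'.
    by apply: contrapT => nU; apply: nm; exists m.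
  have [_ crX _] := pX.
  have [phi [cphi _ phi1 phi0]] :=
    @bump_function R X O° x0 crX (open_interior O) xO.
  have /choice[y yP] n : exists y, (UV (s n)).2 y.
    by have [_ [y ?]] := oV (s n); exists y.
  pose U n := (UV (s n)).1 `&` [set x | `|phi x| < 1 / 2].
  have oUn n : open (U n) /\ U n !=set0.
    split.
      by apply: openI; [exact: (oU _).1 | exact: open_norm_lt].
    have [_ /existsNP[z /not_implyP[Uz nOz]]] := sP n; exists z; split => //=.
    by rewrite phi0 ?normr0 ?divr_gt0// => /interior_subset.
  have xphi : \forall x \near x0, 1 / 2 < `|phi x|.
    by apply: cvgr_norm_gt _ (cphi x0) _ _; rewrite phi1 normr1; lra.
  have [n [[z [[_ /= z1] z2]] _]] := clust U y s (fun n => (sP n).1) oUn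
    (fun n => @subIsetl _ _ _) yP _ setT xphi filterT.
  by have := lt_trans z1 z2; rewrite ltxx.
- move=> O yO; apply: contrapT => nO.
  have /choice[s sP] n : exists m, (n <= m)%N /\ ~ (UV m).2 `<=` O.
    apply: contrapT => nm; apply: nO; exists n => // m /= nm'.
    by apply: contrapT => nV; apply: nm; exists m.
  have /choice[y yP] n : exists y, (UV (s n)).2 y /\ ~ O y.
    by have [_ /existsNP[y /not_implyP]] := sP n; exists y.
  have [n [_]] := clust (fun n => (UV (s n)).1) y s (fun n => (sP n).1)
    (fun n => oU (s n)) (fun n => @subset_refl _ _) (fun n => (yP n).1)
    setT O filterT yO.
  exact: (yP n).2.
Qed.

(** * From converging rectangles to a discontinuity *)

Lemma punctured_open (X : topologicalType) (x0 : X) (U : set X) :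
  accessible_space X -> ~ isolated [set: X] x0 -> open U /\ U !=set0 ->
  open (U `\` [set x0]) /\ U `\` [set x0] !=set0.
Proof.
move=> aX ix0 [oU [z Uz]]; split.
  rewrite setDE; apply: openI => //.
  by apply/closed_openC/accessible_closed_set1.
apply: contrapT => U0; apply: ix0.
have Ux0 w : U w -> w = x0.
  by move=> Uw; apply: contrapT => wx0; apply: U0; exists w.
split; first by rewrite inE.
exists U; first by apply: open_nbhs_nbhs; split=> //; rewrite -(Ux0 z Uz).
by rewrite setIT; apply/seteqP; split=> [w /Ux0//|w ->]; rewrite -(Ux0 z Uz).
Qed.

Lemma sets_converge_locally_finite (X : topologicalType) (U : nat -> set X)
    (x0 x : X) :
  hausdorff_space X -> sets_converge U x0 -> x <> x0 ->
  exists N, \forall w \near x, forall n, (N <= n)%N -> ~ U n w.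
Proof.
rewrite open_hausdorff => hX cU /eqP xx0.
have [[A B] /= [xA x0B] [oA oB AB0]] := hX _ _ xx0; rewrite !inE in xA x0B.
have [N _ UB] := cU B (open_nbhs_nbhs (conj oB x0B)).
exists N; apply: filterS (open_nbhs_nbhs (conj oA xA)) => w Aw n Nn Uw.
have : (A `&` B) w by split => //; exact: UB Uw.
by move/eqP: AB0 => ->.
Qed.

(** With the bumps supported off [x0] and off [y0], the series vanishes
    identically on the cross through [(x0, y0)], and every point other than
    [(x0, y0)] has a neighbourhood on which all but finitely many terms
    vanish. *)
Lemma rectangles_discontinuity (R : realType) (X Y : topologicalType)
    (x0 : X) (y0 : Y) (U : nat -> set X) (V : nat -> set Y) :
  completely_regular_space X -> completely_regular_space Y ->
  hausdorff_space X -> hausdorff_space Y ->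
  ~ isolated [set: X] x0 -> ~ isolated [set: Y] y0 ->
  (forall n, open (U n) /\ U n !=set0) ->
  (forall n, open (V n) /\ V n !=set0) ->
  sets_converge U x0 -> sets_converge V y0 ->
  exists f : X * Y -> R,
     separately_continuous f /\ discontinuity_set f = [set (x0, y0)].
Proof.
move=> crX crY hX hY ix0 iy0 UP VP cU cV.
have U'P n := punctured_open (hausdorff_accessible hX) ix0 (UP n).
have V'P n := punctured_open (hausdorff_accessible hY) iy0 (VP n).
have /choice[x Ux] n : exists x, (U n `\` [set x0]) x.
  by have [_ [x ?]] := U'P n; exists x.
have /choice[y Vy] n : exists y, (V n `\` [set y0]) y.
  by have [_ [y ?]] := V'P n; exists y.
have /choice[phi phiP] n := bump_function R crX (U'P n).1 (Ux n).
have /choice[psi psiP] n := bump_function R crY (V'P n).1 (Vy n).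
pose h n (p : X * Y) : R := phi n p.1 * psi n p.2.
have hge n p : 0 <= h n p.
  by have [_ p0 _ _] := phiP n; have [_ q0 _ _] := psiP n; exact: mulr_ge0.
have hU n p : ~ (U n `\` [set x0]) p.1 -> h n p = 0.
  by have [_ _ _ p0] := phiP n; move=> /p0 p1; rewrite /h p1 mul0r.
have hV n p : ~ (V n `\` [set y0]) p.2 -> h n p = 0.
  by have [_ _ _ p0] := psiP n; move=> /p0 p1; rewrite /h p1 mulr0.
have hc n : continuous (h n).
  move=> p; have [pc _ _ _] := phiP n; have [qc _ _ _] := psiP n.
  apply: continuousM.
    by apply: continuous_comp; [exact: cvg_fst | exact: pc].
  by apply: continuous_comp; [exact: cvg_snd | exact: qc].
pose f := pointwise_series h.
have tail p : p <> (x0, y0) ->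
    exists N, \forall w \near p, forall n, (N <= n)%N -> h n w = 0.
  move=> pxy; have [px|px] := pselect (p.1 = x0); last first.
    have [N xN] := sets_converge_locally_finite hX cU px; exists N.
    have : \forall w \near p, forall n, (N <= n)%N -> ~ U n w.1.
      exact: cvg_fst xN.
    by apply: filterS => w /= wN n /wN nU; apply: hU => -[].
  have py : p.2 <> y0.
    by move=> py; apply: pxy; rewrite -px -py -surjective_pairing.
  have [N xN] := sets_converge_locally_finite hY cV py; exists N.
  have : \forall w \near p, forall n, (N <= n)%N -> ~ V n w.2.
    exact: cvg_snd xN.
  by apply: filterS => w /= wN n /wN nV; apply: hV => -[].
have fc p : p <> (x0, y0) -> {for p, continuous f}.
  move=> /tail[N pN]; apply: (continuous_pointwise_series _ pN) => n.
  exact: hc.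
have fx0 z : f (x0, z) = 0.
  rewrite /f (@pointwise_seriesE _ _ h 0) ?big_ord0// => n _.
  by apply: hU => -[_]; exact.
have fy0 z : f (z, y0) = 0.
  rewrite /f (@pointwise_seriesE _ _ h 0) ?big_ord0// => n _.
  by apply: hV => -[_]; exact.
exists f; split; [split|].
- move=> a b; have [[-> _]|ab] := pselect ((a, b) = (x0, y0)).
    by apply: (@near_cst_continuous _ _ 0); apply: nearW => z; exact: fx0.
  exact: (continuous_slices (fc _ ab)).1.
- move=> b a; have [[_ ->]|ab] := pselect ((a, b) = (x0, y0)).
    by apply: (@near_cst_continuous _ _ 0); apply: nearW => z; exact: fy0.
  exact: (continuous_slices (fc _ ab)).2.
- apply/seteqP; split=> p; first by move=> /= nfc; apply: contrapT => /fc.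
  move=> -> /= fc0.
  have f1 : `|f (x0, y0)| < 1 by rewrite fx0 normr0.
  have [[A B] [/= xA yB] AB] := cvgr_norm_lt _ fc0 _ f1.
  have [N _ UA] := cU A xA; have [M _ VB] := cV B yB.
  pose n := maxn N M.
  have [Unx nx0] := Ux n; have [Vny _] := Vy n.
  have : `|f (x n, y n)| < 1.
    apply: (AB (x n, y n)); split => /=.
      by apply: (UA n _ _ Unx); rewrite /= leq_maxl.
    by apply: (VB n _ _ Vny); rewrite /= leq_maxr.
  rewrite ltNge => /negP; apply; apply: le_trans (ler_norm _).
  have [K /nbhs_singleton xyK] : exists K, \forall w \near (x n, y n),
      forall m, (K <= m)%N -> h m w = 0 by apply: tail => -[/nx0].
  have : h n (x n, y n) <= f (x n, y n) by exact: le_pointwise_series xyK.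
  have [_ _ p1 _] := phiP n; have [_ _ q1 _] := psiP n.
  by rewrite /h /= p1 q1 mulr1.
Qed.

(** * The equivalence *)

Unset Implicit Arguments.

Theorem theorem4p2 (R : realType) (X Y : topologicalType)
  (hXY : (separable_space X /\ pseudocompact_space R X /\ compact_space Y) \/
         (pseudocompact_space R X /\ countable_suslin_number X /\
          valdivia_compact R Y))
  (x0 : X) (y0 : Y)
  (hx0 : ~ isolated [set: X] x0) (hy0 : ~ isolated [set: Y] y0) :
  (exists (U : nat -> set X) (V : nat -> set Y),
     [/\ forall n, open (U n) /\ U n !=set0,
         forall n, open (V n) /\ V n !=set0,
         sets_converge U x0 & sets_converge V y0]) <->
  (exists f : X * Y -> R,
     separately_continuous f /\ discontinuity_set f = [set (x0, y0)]).
Proof.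
have pX : pseudocompact_space R X by case: hXY => [[_ []]|[]].
have [hY cY] : compact_space Y by case: hXY => [[_ []]|[_ [_ []]]].
have [hX crX _] := pX.
have crY : completely_regular_space Y.
  apply: (@normal_completely_regular R); first exact: compact_normal.
  exact: hausdorff_accessible.
split=> [[U [V [oU oV cU cV]]]|[f [[fy fx] Df]]].
  exact (@rectangles_discontinuity R X Y x0 y0 U V
    crX crY hX hY hx0 hy0 oU oV cU cV).
(* Subtracting [h] makes the function vanish on the cross through [(x0, y0)]
   and preserves its points of continuity. *)
pose h (p : X * Y) : R := f (x0, p.2) + f (p.1, y0) - f (x0, y0).
have hc : continuous h.
  move=> p; apply: cvgB; last exact: cvg_cst.
  apply: cvgD.
    apply: (@continuous_comp _ _ _ (@snd X Y) (fun z => f (x0, z))).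
      exact: cvg_snd.
    exact: (fy x0).
  apply: (@continuous_comp _ _ _ (@fst X Y) (fun z => f (z, y0))).
    exact: cvg_fst.
  exact: (fx y0).
pose g p := f p - h p.
have gc p : {for p, continuous f} -> {for p, continuous g}.
  by move=> fp; apply: cvgB; [exact: fp | exact: hc].
have gc' p : {for p, continuous g} -> {for p, continuous f}.
  move=> gp; have -> : f = g \+ h by apply/funext => q; rewrite /= subrK.
  by apply: cvgD; [exact: gp | exact: hc].
have sg : separately_continuous g.
  split=> [x y|y x]; apply: cvgB; [exact: fy | | exact: fx |].
    exact: (continuous_slices (hc (x, y))).1.
  exact: (continuous_slices (hc (x, y))).2.
have [A cA gA] : exists2 A : set X, countable A &
    forall y, (forall a, A a -> g (a, y) = 0) -> forall x, g (x, y) = 0.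
  case: hXY => [[sX _]|[_ [sX _]]]; first exact: separable_kernel sX sg.
  exact: suslin_kernel pX sX cY sg.
have [a aA] := countable_enumeration x0 cA.
apply: (@discontinuity_rectangles R X Y x0 y0 g a) => //.
- by move=> x; rewrite /g /h /= addrAC subrr add0r subrr.
- move=> p pxy; apply: gc; apply: contrapT => nfp; apply: pxy.
  by have : discontinuity_set f p := nfp; rewrite Df.
- move=> /gc' fc0; have : discontinuity_set f (x0, y0) by rewrite Df.
  by apply.
- by move=> y gy; apply: gA => x /aA[n <-].
Qed.
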